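(* There exists a universal constant $\epsilon_0 > 0$ such that for all integers $m\ge 2$, any non-adaptive algorithm for testing whether an unknown function $f:[m]^n\to \{-1,1\}$ is monotone versus $\epsilon_0$-far from monotone must make $\tilde{\Omega}(n^{1/5})$ queries.
   Context: $[m]=\{1,\dots,m\}$. For $x,y\in[m]^n$ write $x\prec y$ if $x_i\le y_i$ for all $i\in[n]$ and $x\ne y$. A function $f:[m]^n\to\{-1,1\}$ is monotone if $f(x)\le f(y)$ whenever $x\prec y$; it is $\epsilon$-close to monotone if $\Pr_{\mathbf{x}\in[m]^n}[f(\mathbf{x})\ne g(\mathbf{x})]\le\epsilon$ (uniform $\mathbf{x}$) for some monotone $g:[m]^n\to\{-1,1\}$, and $\epsilon$-far otherwise. A testing algorithm has query access to $f$ and must output Yes with probability at least $2/3$ if $f$ is monotone and No with probability at least $2/3$ if $f$ is $\epsilon_0$-far from monotone (two-sided error allowed); non-adaptive means its queries do not depend on answers to previous queries. *)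

(* Defs.v *)
From HB Require Import structures.
From mathcomp Require Import all_boot all_order all_algebra.
From mathcomp Require Import all_classical all_reals all_analysis.

Set Implicit Arguments.
Unset Strict Implicit.
Unset Printing Implicit Defensive.
Import Order.TTheory GRing.Theory Num.Theory.
Local Open Scope ring_scope.

(* [m] = {1, ..., m} is represented by 'I_m = {0, ..., m - 1}. *)
Definition grid (m n : nat) : finType := {ffun 'I_n -> 'I_m}.

Definition gprec (m n : nat) (x y : grid m n) : Prop :=
  (forall i : 'I_n, (x i <= y i)%N) /\ x <> y.

(* The range {-1, 1} is represented by bool, with false for -1 and true for 1;
   values are compared through the coercion of bool to nat. *)
Definition monotone (m n : nat) (f : grid m n -> bool) : Prop :=
  forall x y : grid m n, gprec x y -> (f x <= f y)%N.

Definition Pr_neq (R : realType) (m n : nat) (f g : grid m n -> bool) : R :=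
  #|[set x : grid m n | f x != g x]%SET|%:R / #|grid m n|%:R.

Definition close_to_monotone (R : realType) (m n : nat) (eps : R)
    (f : grid m n -> bool) : Prop :=
  exists g : grid m n -> bool, monotone g /\ Pr_neq R f g <= eps.

Definition far_from_monotone (R : realType) (m n : nat) (eps : R)
    (f : grid m n -> bool) : Prop :=
  ~ close_to_monotone eps f.

(* A deterministic non-adaptive algorithm: a list of q query points fixed in
   advance (repetitions allowed, hence at most q distinct queries), and a
   decision, true for Yes, as a function of the q answers. *)
Definition det_algorithm (m n q : nat) : finType :=
  (q.-tuple (grid m n) * {ffun q.-tuple bool -> bool})%type.

Definition output (m n q : nat) (a : det_algorithm m n q)
    (f : grid m n -> bool) : bool :=
  a.2 [tuple of map f a.1].

(* A randomized algorithm is a probability distribution on deterministic ones.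
   As det_algorithm m n q is finite, every source of randomness induces such a
   distribution. *)
Record nonadaptive_algorithm (R : realType) (m n q : nat) := NonadaptiveAlgorithm {
  alg_weight : det_algorithm m n q -> R;
  alg_weight_ge0 : forall a, 0 <= alg_weight a;
  alg_weight_sum1 : \sum_a alg_weight a = 1 }.

Definition Pr_output (R : realType) (m n q : nat)
    (A : nonadaptive_algorithm R m n q) (f : grid m n -> bool) (b : bool) : R :=
  \sum_(a | output a f == b) alg_weight A a.

Definition tests_monotonicity (R : realType) (m n q : nat) (eps : R)
    (A : nonadaptive_algorithm R m n q) : Prop :=
  forall f : grid m n -> bool,
    (monotone f -> 2%:R / 3%:R <= Pr_output A f true) /\
    (far_from_monotone eps f -> 2%:R / 3%:R <= Pr_output A f false).

(* Main.v *)
Require Import Defs.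
From HB Require Import structures.
From mathcomp Require Import all_boot all_order all_algebra.
From mathcomp Require Import all_classical all_reals all_analysis.
From mathcomp Require Import ring lra zify.

Set Implicit Arguments.
Unset Strict Implicit.
Unset Printing Implicit Defensive.
Import Order.TTheory GRing.Theory Num.Theory.
Local Open Scope ring_scope.

(** Write [b a = 1] if [a] lies in the upper half of [[m]] and [b a = 0] otherwise. Both hard
    distributions consist of threshold functions [x |-> [sum_i (w_i - 1) b(x_i) >= th]] with
    independent [w_i] in [{0, ..., L}] and [th] uniform in a window of length about [sqrt n].
    In the yes case [w_i] is odd and in the no case even, in both cases with probability
    proportional to ['C(L, w_i)]; so all weights are nonnegative in the yes case, while a
    constant fraction of them is [-1] in the no case.

    Exchanging one [w_i] from one parity to the other changes an expectation by an [L]-th finite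
    difference. If the [q]-dimensional vector of scores of the queries is perturbed by [L]
    independent noises uniform in [{0, ..., D - 1}^q], this difference is at most [(2 q / D)^L],
    and the random threshold makes the effect of the noise on the answers at most
    [L q D / sqrt n]. For [L = 21], [q <= n^(1/5)] and [D] about [n^(1/4)], both [n (2 q / D)^L]
    and [L q D / sqrt n] tend to [0].

    A no function [f] is far from every monotone [g]: let [Q+] and [Q-] be the product measures
    in which the coordinates of weight [-1] are tilted upwards, resp. downwards, by
    [C / sqrt n]. Then [f] is mostly [0] under [Q+] and mostly [1] under [Q-], whereas [g] is
    at least as likely to be [1] under [Q+] as under [Q-]. So [f] and [g] differ with constant
    probability under [Q+] or [Q-], hence under the uniform measure, with respect to which the
    densities of [Q+] and [Q-] have bounded second moment. *)

(** * Finite product measures: resampling, Chebyshev's inequality, hybrids *)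

Section ProductWeights.
Variables (R : realFieldType) (I T : finType).
Implicit Types (d : I -> T -> R) (w : {ffun I -> T}) (h : {ffun I -> T} -> R).

Definition upd w i a : {ffun I -> T} := [ffun j => if j == i then a else w j].

Definition prodw d w : R := \prod_i d i (w i).

Definition Ex d h : R := \sum_w prodw d w * h w.

Definition is_distr d := (forall i a, 0 <= d i a) /\ (forall i, \sum_a d i a = 1).

Lemma upd_same w i a : upd w i a i = a.
Proof. by rewrite ffunE eqxx. Qed.

Lemma upd_other w i j a : j != i -> upd w i a j = w j.
Proof. by rewrite ffunE => /negbTE ->. Qed.

Lemma upd_upd w i a b : upd (upd w i a) i b = upd w i b.
Proof. by apply/ffunP => j; rewrite !ffunE; case: eqP. Qed.

Lemma upd_id w i : upd w i (w i) = w.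
Proof. by apply/ffunP => j; rewrite !ffunE; case: eqP => // ->. Qed.

Lemma sum_upd (F : {ffun I -> T} -> T -> R) i :
  \sum_w \sum_a F (upd w i a) (w i) = \sum_w \sum_a F w a.
Proof.
rewrite !pair_bigA /=.
pose swap (p : {ffun I -> T} * T) := (upd p.1 i p.2, p.1 i).
have swapK : involutive swap.
  by case=> w a; rewrite /swap /= upd_upd upd_id upd_same.
by rewrite [RHS](reindex_inj (inv_inj swapK)).
Qed.

Lemma prodw_upd d w i a :
  prodw d (upd w i a) = d i a * \prod_(j | j != i) d j (w j).
Proof.
rewrite /prodw (bigD1 i) //= upd_same; congr (_ * _).
by apply: eq_bigr => j ji; rewrite upd_other.
Qed.

Lemma prodw_ge0 d w : (forall i a, 0 <= d i a) -> 0 <= prodw d w.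
Proof. by move=> d0; apply: prodr_ge0. Qed.

(** Resampling: draw [w] from [d], then replace coordinate [i] by a fresh value weighted by [d' i];
    the old value integrates out to 1. *)
Lemma Ex_change d d' i h :
  \sum_a d i a = 1 -> (forall j, j != i -> d' j = d j) ->
  Ex d' h = Ex d (fun w => \sum_a d' i a * h (upd w i a)).
Proof.
move=> d1 dd'; rewrite /Ex.
under [RHS]eq_bigr => w _ do rewrite mulr_sumr.
pose F w a := prodw d (upd w i a) * (d' i (w i) * h w).
transitivity (\sum_w \sum_a F w a); last first.
  rewrite -(sum_upd F i); apply: eq_bigr => w _; apply: eq_bigr => a _.
  by rewrite /F upd_upd upd_id upd_same.
apply: eq_bigr => w _; rewrite /F -mulr_suml mulrA; congr (_ * _).
under eq_bigr => a _ do rewrite prodw_upd.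
rewrite -mulr_suml d1 mul1r mulrC /prodw (bigD1 i) //=; congr (_ * _).
by apply: eq_bigr => j ji; rewrite dd'.
Qed.

Lemma Ex1 d : is_distr d -> Ex d (fun=> 1) = 1.
Proof.
move=> [_ d1]; rewrite /Ex; under eq_bigr => w _ do rewrite mulr1 /prodw.
rewrite -(bigA_distr_bigA (fun i a => d i a)) /= big1 //.
Qed.

Lemma Ex_cst d c : is_distr d -> Ex d (fun=> c) = c.
Proof.
move=> dd; rewrite -[RHS]mul1r -(Ex1 dd) /Ex mulr_suml.
by apply: eq_bigr => w _; rewrite mulr1.
Qed.

Lemma eq_Ex d h1 h2 : h1 =1 h2 -> Ex d h1 = Ex d h2.
Proof. by move=> e; apply: eq_bigr => w _; rewrite e. Qed.

Lemma ExD d h1 h2 : Ex d (fun w => h1 w + h2 w) = Ex d h1 + Ex d h2.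
Proof. by rewrite -big_split; apply: eq_bigr => w _; rewrite mulrDr. Qed.

Lemma ExZ d c h : Ex d (fun w => c * h w) = c * Ex d h.
Proof. by rewrite mulr_sumr; apply: eq_bigr => w _; rewrite mulrCA. Qed.

Lemma ExB d h1 h2 : Ex d (fun w => h1 w - h2 w) = Ex d h1 - Ex d h2.
Proof. by rewrite -sumrB; apply: eq_bigr => w _; rewrite mulrBr. Qed.

Lemma Ex_sum (J : finType) d (F : J -> {ffun I -> T} -> R) :
  Ex d (fun w => \sum_j F j w) = \sum_j Ex d (F j).
Proof. by rewrite exchange_big; apply: eq_bigr => w _; rewrite mulr_sumr. Qed.

Lemma le_Ex_supp d h1 h2 : (forall i a, 0 <= d i a) ->
  (forall w, (forall i, d i (w i) != 0) -> h1 w <= h2 w) -> Ex d h1 <= Ex d h2.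
Proof.
move=> d0 le12; apply: ler_sum => w _.
have [/forallP nz|] := boolP [forall i, d i (w i) != 0].
  by apply: ler_wpM2l; [exact: prodw_ge0 | exact: le12].
rewrite negb_forall => /existsP[i /negPn/eqP di0].
by rewrite /prodw (bigD1 i) //= di0 !mul0r.
Qed.

Lemma le_Ex d h1 h2 : (forall i a, 0 <= d i a) ->
  (forall w, h1 w <= h2 w) -> Ex d h1 <= Ex d h2.
Proof. by move=> d0 le12; apply: le_Ex_supp. Qed.

Lemma ler_norm_Ex d h : (forall i a, 0 <= d i a) ->
  `|Ex d h| <= Ex d (fun w => `|h w|).
Proof.
move=> d0; apply: le_trans (ler_norm_sum _ _ _) _; apply: ler_sum => w _.
by rewrite normrM ger0_norm // prodw_ge0.
Qed.

Lemma Ex_marginal d i (g : T -> R) : is_distr d ->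
  Ex d (fun w => g (w i)) = \sum_a d i a * g a.
Proof.
move=> dd; have [d0 d1] := dd; rewrite (@Ex_change d d i) // -[RHS](Ex_cst _ dd).
by apply: eq_Ex => w; apply: eq_bigr => a _; rewrite upd_same.
Qed.

(** Independent centred variables are orthogonal: resampling coordinate [i] alone kills each cross
    term, and each diagonal term is at most [M ^+ 2]. *)
Lemma Ex_sqr_sum d (Y : I -> T -> R) (M : R) : is_distr d ->
  (forall i, \sum_a d i a * Y i a = 0) -> (forall i a, `|Y i a| <= M) ->
  Ex d (fun w => (\sum_i Y i (w i)) ^+ 2) <= #|I|%:R * M ^+ 2.
Proof.
move=> dd Y0 YM; have [d0 d1] := dd.
rewrite (@eq_Ex _ _ (fun w => \sum_i \sum_j Y i (w i) * Y j (w j))); last first.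
  by move=> w; rewrite expr2 mulr_suml; apply: eq_bigr => i _; rewrite mulr_sumr.
rewrite Ex_sum; have -> : #|I|%:R * M ^+ 2 = \sum_(i : I) M ^+ 2.
  by rewrite sumr_const -[RHS]mulr_natl.
apply: ler_sum => i _; rewrite Ex_sum (bigD1 i) //= big1 ?addr0.
  rewrite -[leRHS](Ex_cst _ dd); apply: le_Ex => // w.
  by rewrite -expr2 -[leLHS]real_normK ?num_real // lerXn2r ?nnegrE // (le_trans _ (YM i (w i))).
move=> j ji; rewrite (@Ex_change d d i) //.
rewrite (@eq_Ex _ _ (fun=> 0)) ?Ex_cst // => w.
under eq_bigr => a _ do rewrite upd_same upd_other // mulrA.
by rewrite -mulr_suml Y0 mul0r.
Qed.

Lemma chebyshev_prodw d (Y : I -> T -> R) (M t : R) : is_distr d ->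
  (forall i, \sum_a d i a * Y i a = 0) -> (forall i a, `|Y i a| <= M) -> 0 < t ->
  Ex d (fun w => (t <= `|\sum_i Y i (w i)|)%R%:R) <= #|I|%:R * M ^+ 2 / t ^+ 2.
Proof.
move=> dd Y0 YM t0; rewrite ler_pdivlMr ?exprn_gt0 // mulrC -ExZ.
apply: le_trans (Ex_sqr_sum dd Y0 YM); apply: le_Ex => [|w]; first by case: dd.
case: (leP t) => tY; last by rewrite /= mulr0 sqr_ge0.
by rewrite /= mulr1 -[leRHS]real_normK ?num_real // lerXn2r ?nnegrE // ltW.
Qed.

End ProductWeights.

(** Hybrid argument: [H k] uses [d] on the first [k] coordinates and [d'] on the rest, so
    consecutive hybrids differ in one coordinate only. *)
Lemma Ex_hybrid (R : realFieldType) (T : finType) (n : nat) (d d' : 'I_n -> T -> R)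
    (h : {ffun 'I_n -> T} -> R) (eps : R) :
  is_distr d -> is_distr d' ->
  (forall i w, \sum_a (d i a - d' i a) * h (upd w i a) <= eps) ->
  Ex d h - Ex d' h <= n%:R * eps.
Proof.
move=> [d0 d1] [d'0 d'1] le_eps.
pose H (k : nat) (i : 'I_n) := if (i < k)%N then d i else d' i.
have H0 k i a : 0 <= H k i a by rewrite /H; case: ifP.
have H1 k i : \sum_a H k i a = 1 by rewrite /H; case: ifP.
have step k : (k <= n)%N -> Ex (H k) h - Ex d' h <= k%:R * eps.
  elim: k => [|k IHk] kn.
    by rewrite mul0r subr_le0 (_ : Ex (H 0) h = Ex d' h).
  pose i := Ordinal kn.
  have HSk j : j != i -> H k.+1 j = H k j.
    move=> ji; rewrite /H ltnS leq_eqVlt.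
    by have -> : (j == k :> nat) = false by apply: contraNF ji => /eqP e; apply/eqP/val_inj.
  have Hi : H k i = d' i by rewrite /H ltnn.
  have HSi : H k.+1 i = d i by rewrite /H ltnSn.
  have -> : Ex (H k.+1) h - Ex d' h = (Ex (H k.+1) h - Ex (H k) h) + (Ex (H k) h - Ex d' h).
    by rewrite addrA subrK.
  rewrite -natr1 mulrDl mul1r addrC; apply: lerD; first exact: IHk (ltnW kn).
  rewrite (@Ex_change _ _ _ (H k) _ i _ (H1 k i) HSk).
  rewrite (@Ex_change _ _ _ (H k) (H k) i h (H1 k i)) // -ExB.
  rewrite -[leRHS](@Ex_cst _ _ _ (H k)) //; apply: le_Ex => // w.
  rewrite -sumrB Hi HSi; apply: le_trans (le_eps i w).
  by under eq_bigr => a _ do rewrite -mulrBl.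
have := step n (leqnn n).
have -> : Ex (H n) h = Ex d h; last by [].
by apply: eq_bigr => w _; congr (_ * _); apply: eq_bigr => j _; rewrite /H ltn_ord.
Qed.

(** * Smoothing by uniform noise, and finite differences *)

Definition unifw (R : realFieldType) (I T : finType) : I -> T -> R :=
  fun _ _ => #|T|%:R^-1.

Lemma unifw_distr (R : realFieldType) (I T : finType) :
  (0 < #|T|)%N -> is_distr (@unifw R I T).
Proof.
move=> T0; split=> [i a|i]; first by rewrite invr_ge0 ler0n.
by rewrite sumr_const -[LHS]mulr_natl divff // pnatr_eq0 -lt0n.
Qed.

Section Smoothing.
Variables (R : realFieldType) (q D : nat).
Local Notation V := {ffun 'I_q -> int}.
Local Notation noises := {ffun 'I_q -> 'I_D.+1}.
Implicit Types (F : V -> R) (s v : V).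

Definition noise (u : noises) : V := [ffun j => (u j)%:Z].

Definition smooth F s : R := Ex (@unifw R _ _) (fun u : noises => F (s + noise u)).

(** The sign is chosen so that the [k]-th iterate has coefficients [(-1) ^+ j * 'C(k, j)], which is
    the form of [pwB]. *)
Definition fdiff v F s : R := F s - F (s + v).

Let unifD : is_distr (@unifw R 'I_q 'I_D.+1).
Proof. by apply: unifw_distr; rewrite card_ord. Qed.

Let unifD0 : forall i a, 0 <= @unifw R 'I_q 'I_D.+1 i a.
Proof. by case: unifD. Qed.

Definition boolvec (beta : 'I_q -> bool) : V := [ffun j => (beta j : nat)%:Z].

(* Translating the noise by [v] agrees with a cyclic translation, which leaves
   the uniform distribution invariant, unless some coordinate wraps around. *)
Lemma fdiff_smooth_le F (M : R) beta s : (forall s', `|F s'| <= M) ->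
  `|fdiff (boolvec beta) (smooth F) s| <= 2 * q%:R / D.+1%:R * M.
Proof.
move=> FM; have M0 : 0 <= M by apply: le_trans (FM s).
pose cyc (u : noises) : noises := [ffun j => if beta j then ordS (u j) else u j].
have cyc_inj : injective cyc.
  move=> u u' /ffunP e; apply/ffunP => j; have := e j; rewrite !ffunE.
  by case: (beta j) => // /(can_inj (@ordSK _)).
have smooth_cyc : smooth F s = Ex (@unifw R _ _) (fun u => F (s + noise (cyc u))).
  rewrite /smooth /Ex (reindex_inj cyc_inj) /=; apply: eq_bigr => u _.
  by congr (_ * _); apply: eq_bigr => j _.
rewrite /fdiff smooth_cyc /smooth -ExB.
apply: le_trans (ler_norm_Ex _ unifD0) _.
(* Union bound: a wrap costs at most [2 * M], and each of the [q] coordinates sits at the top value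
   with probability [1 / D.+1]. *)
apply: (@le_trans _ _ (Ex (@unifw R _ _)
  (fun u : noises => 2 * M * \sum_j (u j == ord_max)%:R))); last first.
  rewrite ExZ Ex_sum (eq_bigr (fun=> D.+1%:R^-1)); last first.
    move=> j _; rewrite (Ex_marginal _ (fun a => (a == ord_max)%:R)) //.
    rewrite (bigD1 ord_max) //= big1 => [|a /negbTE -> ]; last by rewrite mulr0.
    by rewrite eqxx mulr1 addr0 /unifw card_ord.
  rewrite sumr_const card_ord -[X in 2 * M * X]mulr_natr.
  by rewrite le_eqVlt; apply/orP; left; apply/eqP; ring.
apply: le_Ex => // u.
have [/existsP[j uj]|] := boolP [exists j, u j == ord_max].
  apply: (@le_trans _ _ (2 * M)).
    by apply: le_trans (ler_normB _ _) _; rewrite mulr2n mulrDl mul1r lerD.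
  by rewrite ler_peMr ?mulr_ge0 // (bigD1 j) //= uj lerDl sumr_ge0.
rewrite negb_exists => /forallP nomax.
have -> : noise (cyc u) = boolvec beta + noise u.
  apply/ffunP => j; rewrite !ffunE; case: (beta j) => //=.
  have := nomax j; rewrite -val_eqE /= => ujD.
  rewrite modn_small; first by rewrite -[X in X%:Z]add1n PoszD.
  by have := ltn_ord (u j); rewrite !ltnS leq_eqVlt (negbTE ujD).
rewrite addrA subrr normr0 mulr_ge0 ?mulr_ge0 // sumr_ge0 //.
Qed.

Lemma fdiff_smooth v F : fdiff v (smooth F) = smooth (fdiff v F).
Proof.
apply/funext => s; rewrite /fdiff /smooth -ExB; apply: eq_Ex => u.
by rewrite addrAC.
Qed.

(** Differences commute with smoothing, so each of the [k] differences meets its own layer of noise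
    and gains a factor [2 * q / D.+1]. *)
Lemma iter_fdiff_smooth_le k F (M : R) beta s : (forall s', `|F s'| <= M) ->
  `|iter k (fdiff (boolvec beta)) (iter k smooth F) s| <= (2 * q%:R / D.+1%:R) ^+ k * M.
Proof.
elim: k F M s => [|k IHk] F M s FM; first by rewrite mul1r.
have fdiff_iter G : fdiff (boolvec beta) (iter k smooth G) = iter k smooth (fdiff (boolvec beta) G).
  by elim: k {IHk} G => //= k IH G; rewrite fdiff_smooth IH.
rewrite iterSr [iter k.+1 smooth F]iterSr fdiff_iter exprSr -mulrA.
by apply: IHk => s'; apply: fdiff_smooth_le.
Qed.

Lemma iter_smooth_near k F (kappa : R) s :
  (forall s' (u : noises), `|F (s' + noise u) - F s'| <= kappa) ->
  `|iter k smooth F s - F s| <= k%:R * kappa.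
Proof.
move=> Fk; elim: k s => [|k IHk] s; first by rewrite /= subrr normr0 mul0r.
rewrite iterS /smooth -[X in _ - X](Ex_cst _ unifD) -ExB.
apply: le_trans (ler_norm_Ex _ unifD0) _.
rewrite -[leRHS](Ex_cst _ unifD); apply: le_Ex => // u.
rewrite -natr1 mulrDl mul1r.
rewrite -[X in `|X|](subrKA (F (s + noise u))).
by apply: le_trans (ler_normD _ _) _; apply: lerD.
Qed.

Lemma iter_fdiffE k v F s :
  iter k (fdiff v) F s = \sum_(j < k.+1) (-1) ^+ j * 'C(k, j)%:R * F (s + v *+ j).
Proof.
elim: k F s => [|k IHk] F s.
  by rewrite big_ord1 /= expr0 bin0 !mul1r mulr0n addr0.
rewrite iterS /fdiff !IHk big_ord_recl [in RHS]big_ord_recl !bin0 -addrA; congr (_ + _).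
transitivity (\sum_(i < k.+1) (-1) ^+ i.+1 * 'C(k, i.+1)%:R * F (s + v *+ i.+1)
  - \sum_(j < k.+1) (-1) ^+ j * 'C(k, j)%:R * F (s + v *+ j.+1)).
  congr (_ - _).
    by rewrite [RHS]big_ord_recr /= bin_small // mulr0 mul0r addr0.
  by apply: eq_bigr => j _; rewrite mulrS addrA.
rewrite -sumrB; apply: eq_bigr => j _; rewrite /= binS natrD exprS.
by ring.
Qed.

End Smoothing.

(** * Binomial weights restricted to one parity *)

Section ParityWeights.
Variables (R : realFieldType) (L : nat).

Definition parity_mass : R := \sum_(j < L.+1) (~~ odd j)%:R * 'C(L, j)%:R.

Definition pw (b : bool) (j : 'I_L.+1) : R :=
  (odd j == b)%:R * 'C(L, j)%:R / parity_mass.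

Lemma parity_mass_ge1 : 1 <= parity_mass.
Proof.
by rewrite /parity_mass big_ord_recl /= mul1r bin0 lerDl sumr_ge0.
Qed.

Let mass_gt0 : 0 < parity_mass := lt_le_trans ltr01 parity_mass_ge1.

Lemma pw_ge0 b j : 0 <= pw b j.
Proof. by rewrite divr_ge0 ?mulr_ge0 // ltW. Qed.

Lemma pwB j : pw false j - pw true j = (-1) ^+ j * 'C(L, j)%:R / parity_mass.
Proof.
rewrite -mulrBl -mulrBl -signr_odd; case: (odd j) => /=.
  by rewrite expr1 sub0r.
by rewrite expr0 subr0.
Qed.

(** Even and odd binomial coefficients balance because [(1 - 1) ^+ L = 0] for [L > 0]; hence one
    constant normalises both parities. *)
Lemma pw_sum b : (0 < L)%N -> \sum_j pw b j = 1.
Proof.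
move=> L0; have pwF : \sum_j pw false j = 1.
  rewrite -mulr_suml (eq_bigr (fun j : 'I_L.+1 => (~~ odd j)%:R * 'C(L, j)%:R)).
    by rewrite divff // gt_eqF.
  by move=> j _; case: (odd j).
case: b => //; apply/eqP; rewrite -subr_eq0 -pwF -sumrB -oppr_eq0 -sumrN.
under eq_bigr => j _ do rewrite opprB pwB.
rewrite -mulr_suml (_ : \sum_(i < L.+1) _ = (1 - 1) ^+ L).
  by rewrite subrr expr0n eqn0Ngt L0 mul0r.
by rewrite exprBn; apply: eq_bigr => j _; rewrite !expr1n !mulr1 mulr_natr.
Qed.

Lemma pw_distr (I : finType) b : (0 < L)%N -> is_distr (fun _ : I => pw b).
Proof. by move=> L0; split=> [i a|i]; [exact: pw_ge0 | exact: pw_sum]. Qed.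

Lemma pw_ord0 : pw false ord0 = parity_mass^-1.
Proof. by rewrite /pw /= bin0 !mul1r. Qed.

End ParityWeights.

(** * Acceptance under a random threshold, as a function of the scores *)

Section RandomThreshold.
Variables (R : realFieldType) (q T : nat) (h : q.-tuple bool -> bool) (th0 : int).
Local Notation V := {ffun 'I_q -> int}.

Definition signs (s : V) (th : int) : q.-tuple bool := [tuple (th <= s j)%R | j < q].

(** The probability that the decision [h] says Yes when the queries have scores [s] and the
    threshold is uniform in a window of length [T]. *)
Definition psi (s : V) : R := (\sum_(t < T) (h (signs s (th0 + t%:Z)))%:R) / T%:R.

Lemma psi_le1 s : `|psi s| <= 1.
Proof.
rewrite ger0_norm; last by rewrite divr_ge0 ?sumr_ge0.
case: (posnP T) => [T0|T0]; first by rewrite /psi T0 invr0 mulr0.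
rewrite ler_pdivrMr ?ltr0n // mul1r -[X in _ <= X%:R](card_ord T) -sumr_const.
by apply: ler_sum => t _; case: h.
Qed.

(** Double counting of the pairs [(t, k)] with [t = a + 1 + k] and [k < u]: each [k] is met by at
    most one [t]. *)
Lemma window_count (a : int) (u : nat) :
  \sum_(t < T) ((a < t%:Z)%R && (t%:Z <= a + u%:Z)%R)%:R <= u%:R :> R.
Proof.
apply: (@le_trans _ _ (\sum_(t < T) \sum_(k < u) (t%:Z == a + 1 + k%:Z)%R%:R)).
  apply: ler_sum => t _; have [/andP[lt_a le_u]|_] := boolP (_ && _); last by rewrite sumr_ge0.
  have ku : (absz (t%:Z - a - 1)%R < u)%N by lia.
  rewrite (bigD1 (Ordinal ku)) //= (_ : (_ == _) = true) ?lerDl ?sumr_ge0 //.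
  by apply/eqP; lia.
rewrite exchange_big /= -[X in _ <= X%:R](card_ord u) -sumr_const.
apply: ler_sum => k _; rewrite -natr_sum lern1.
have [/existsP[t0 /eqP et0]|] := boolP [exists t : 'I_T, t%:Z == a + 1 + k%:Z].
  rewrite (bigD1 t0) //= big1 ?addn0 ?leq_b1 // => t tt0.
  by rewrite -et0 (_ : (_ == _) = false) //; apply: contraNF tt0 => /eqP[] /val_inj ->.
by rewrite negb_exists => /forallP no; rewrite big1 // => t _; rewrite (negbTE (no t)).
Qed.

(** A threshold separates [s] from [s + noise u] only if it lies above [s j] and not above
    [s j + u j] for some [j]; each [j] accounts for at most [D] of the [T] thresholds. *)
Lemma psi_near D s (u : {ffun 'I_q -> 'I_D.+1}) :
  `|psi (s + noise u) - psi s| <= q%:R * D.+1%:R / T%:R.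
Proof.
rewrite -mulrBl -sumrB normrM [X in _ * X]ger0_norm ?invr_ge0 //.
apply: ler_wpM2r; first by rewrite invr_ge0.
apply: le_trans (ler_norm_sum _ _ _) _.
apply: (@le_trans _ _ (\sum_(t < T) \sum_(j < q)
   ((s j - th0 < t%:Z)%R && (t%:Z <= s j - th0 + (u j)%:Z)%R)%:R)); last first.
  rewrite exchange_big /= (_ : q%:R * _ = \sum_(j < q) D.+1%:R); last first.
    by rewrite sumr_const card_ord -[RHS]mulr_natl.
  apply: ler_sum => j _; apply: le_trans (window_count _ _) _.
  by rewrite ler_nat ltnW.
apply: ler_sum => t _.
have [/existsP[j hj]|] := boolP [exists j,
    ((s j - th0 < t%:Z) && (t%:Z <= s j - th0 + (u j)%:Z))].
  apply: (@le_trans _ _ 1).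
    by case: (h _); case: (h _); rewrite ?subrr ?subr0 ?sub0r ?normrN ?normr0 ?normr1.
  by rewrite (bigD1 j) //= hj lerDl sumr_ge0.
rewrite negb_exists => /forallP no.
rewrite (_ : signs (s + noise u) _ = signs s (th0 + t%:Z)).
  by rewrite subrr normr0 sumr_ge0.
apply: eq_from_tnth => j; rewrite !tnth_mktuple !ffunE.
by have := no j; set sj := s j; clearbody sj; lia.
Qed.

End RandomThreshold.

(** * The hard threshold functions *)

Definition high m (a : 'I_m) : bool := (m./2 <= a)%N.

(* Entry [k] of [w] stands for the weight [k - 1], so [ord0] is the only negative weight. *)
Definition score m n L (w : {ffun 'I_n -> 'I_L.+1}) (x : grid m n) : int :=
  \sum_i ((w i)%:Z - 1) *+ high (x i).

Definition ltf m n L (w : {ffun 'I_n -> 'I_L.+1}) (th : int) (x : grid m n) : bool :=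
  (th <= score w x)%R.

(** * Yes and no instances give nearly the same answers *)

Section Indistinguishability.
Variables (R : realFieldType) (m n q L D T : nat) (th0 : int).
Variable a : det_algorithm m n q.
Hypothesis L_gt0 : (0 < L)%N.

(** Coordinate [i] across the [q] queries: increasing [w i] by one translates the vector of scores
    by this 0-1 vector. *)
Let col (i : 'I_n) : {ffun 'I_q -> int} := boolvec (fun j => high (tnth a.1 j i)).

Let scores (w : {ffun 'I_n -> 'I_L.+1}) : {ffun 'I_q -> int} :=
  [ffun j => score w (tnth a.1 j)].

Let Psi := @psi R q T a.2 th0.

Lemma avg_outputE w :
  (\sum_(t < T) (output a (ltf w (th0 + t%:Z)))%:R) / T%:R = Psi (scores w).
Proof.
congr (_ / _); apply: eq_bigr => t _; congr ((a.2 _ : nat)%:R).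
by apply: eq_from_tnth => j; rewrite tnth_map tnth_mktuple ffunE.
Qed.

Lemma scores_upd w i k : scores (upd w i k) = scores (upd w i ord0) + col i *+ k.
Proof.
apply/ffunP => j; rewrite !ffunE ffunMnE ffunE /score (bigD1 i) //= [in RHS](bigD1 i) //=.
rewrite !upd_same addrAC; congr (_ + _); first by case: high => /=; lia.
by apply: eq_bigr => l li; rewrite !upd_other.
Qed.

(** The two laws of [w i] differ by signed binomial coefficients, so the sum is an [L]-th difference
    in direction [col i], with one layer of noise per difference; dividing by a mass of at least 1
    only helps. *)
Lemma smoothed_swap (F := iter L (@smooth R q D) Psi) i w :
  `|\sum_k (pw R false k - pw R true k) * F (scores (upd w i k))|
    <= (2 * q%:R / D.+1%:R) ^+ L.
Proof.
have mass1 := parity_mass_ge1 R L.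
have -> : \sum_k (pw R false k - pw R true k) * F (scores (upd w i k)) =
    iter L (fdiff (col i)) F (scores (upd w i ord0)) / parity_mass R L.
  rewrite iter_fdiffE mulr_suml; apply: eq_bigr => k _.
  by rewrite pwB -scores_upd; ring.
rewrite normrM normfV (@ger0_norm _ (parity_mass _ _)) ?(le_trans ler01) //.
rewrite ler_pdivrMr ?(lt_le_trans ltr01) //.
apply: (@le_trans _ _ ((2 * q%:R / D.+1%:R) ^+ L * 1)).
  by apply: iter_fdiff_smooth_le => s; apply: psi_le1.
by apply: ler_wpM2l => //; rewrite exprn_ge0 // divr_ge0 ?mulr_ge0.
Qed.

(** Smoothing is paid for twice, once in each expectation; the exchange of laws is paid for once per
    coordinate. *)
Lemma indistinguishable
    (avg_out := fun w : {ffun 'I_n -> 'I_L.+1} =>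
       (\sum_(t < T) (output a (ltf w (th0 + t%:Z)))%:R) / T%:R) :
  `|Ex (fun=> pw R false) avg_out - Ex (fun=> pw R true) avg_out| <=
  2 * (L%:R * (q%:R * D.+1%:R / T%:R)) + n%:R * (2 * q%:R / D.+1%:R) ^+ L.
Proof.
rewrite !(eq_Ex _ avg_outputE).
pose F := iter L (@smooth R q D) Psi.
have [dF dT] := (pw_distr R 'I_n false L_gt0, pw_distr R 'I_n true L_gt0).
set err := L%:R * _.
have near b : `|Ex (fun=> pw R b) (fun w : {ffun 'I_n -> 'I_L.+1} => Psi (scores w)) -
    Ex (fun=> pw R b) (fun w => F (scores w))| <= err.
  have [d0 d1] := pw_distr R 'I_n b L_gt0.
  rewrite -ExB; apply: le_trans (ler_norm_Ex _ d0) _.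
  rewrite -[leRHS](Ex_cst _ (pw_distr R 'I_n b L_gt0)); apply: le_Ex => // w.
  by rewrite distrC; apply: iter_smooth_near => s u; apply: psi_near.
have hybF : Ex (fun=> pw R false) (fun w => F (scores w)) -
    Ex (fun=> pw R true) (fun w => F (scores w)) <= n%:R * (2 * q%:R / D.+1%:R) ^+ L.
  by apply: Ex_hybrid => // i w; apply: le_trans (ler_norm _) (smoothed_swap i w).
have hybT : Ex (fun=> pw R true) (fun w => F (scores w)) -
    Ex (fun=> pw R false) (fun w => F (scores w)) <= n%:R * (2 * q%:R / D.+1%:R) ^+ L.
  apply: Ex_hybrid => // i w; apply: le_trans (smoothed_swap i w).
  apply: le_trans (ler_norm _) _; rewrite -normrN -sumrN.
  by under eq_bigr => k _ do rewrite -mulNr opprB.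
move: (near false) (near true) hybF hybT; rewrite !ler_norml; lra.
Qed.

End Indistinguishability.

(** * Product measures tilted towards or away from the upper half *)

Lemma high_count (R : realFieldType) (m : nat) :
  \sum_(a < m) (high a)%:R = (m - m./2)%:R :> R.
Proof.
(* Freeing the cut-off from [m] lets the induction vary the range alone. *)
rewrite -natr_sum; congr (_%:R); rewrite /high; move: (m./2) => k.
elim: m => [|l IH]; first by rewrite big_ord0.
by rewrite big_ord_recr /= IH; lia.
Qed.

Section Tilting.
Variables (R : realFieldType) (m n : nat).
Hypothesis m_ge2 : (2 <= m)%N.

Let m_gt0 : 0 < m%:R :> R.
Proof. by rewrite ltr0n; lia. Qed.

Definition hfrac : R := (\sum_(a < m) (high a)%:R) / m%:R.

Let phi (a : 'I_m) : R := (high a)%:R - hfrac.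

Lemma hfracM : hfrac * m%:R = \sum_(a < m) (high a)%:R.
Proof. by rewrite mulfVK // gt_eqF. Qed.

(** The fraction is 1/2 for even [m] and [(m + 1) / (2 * m)] for odd [m], hence largest at [m = 3].
    These bounds keep later constants independent of [m]. *)
Lemma hfrac_bounds : 1 / 3 <= hfrac <= 2 / 3.
Proof.
have h1 : 3 * (m - m./2)%N%:R <= 2 * m%:R :> R by rewrite -!natrM ler_nat; lia.
have h2 : m%:R <= 3 * (m - m./2)%N%:R :> R by rewrite -!natrM ler_nat; lia.
rewrite /hfrac high_count ler_pdivlMr // ler_pdivrMr //.
by apply/andP; split; lra.
Qed.

Lemma hvar_ge : 2 / 9 <= hfrac * (1 - hfrac).
Proof. have /andP[? ?] := hfrac_bounds; nra. Qed.

Let phi_sum0 : \sum_a phi a = 0.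
Proof. by rewrite sumrB sumr_const card_ord -[X in _ - X]mulr_natr hfracM subrr. Qed.

Let phi_high : \sum_a phi a * (high a)%:R = hfrac * (1 - hfrac) * m%:R.
Proof.
rewrite mulrAC hfracM mulr_suml; apply: eq_bigr => a _.
by rewrite /phi; case: high => /=; ring.
Qed.

Let phi_sqr : \sum_a phi a ^+ 2 = hfrac * (1 - hfrac) * m%:R.
Proof.
rewrite -phi_high; under eq_bigr => a _ do rewrite expr2 [X in _ * X]/phi mulrBr.
by rewrite sumrB -mulr_suml phi_sum0 mul0r subr0.
Qed.

Let phi_le1 a : `|phi a| <= 1.
Proof.
have /andP[? ?] := hfrac_bounds.
by rewrite ler_norml /phi; case: high => /=; lra.
Qed.

Definition tilt (dl : 'I_n -> R) (i : 'I_n) (a : 'I_m) : R :=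
  (1 + dl i * phi a) / m%:R.

Lemma tilt_distr dl : (forall i, `|dl i| <= 1) -> is_distr (tilt dl).
Proof.
move=> dl1; split=> [i a|i].
  apply: divr_ge0; last exact: ltW.
  rewrite -lerBlDl sub0r.
  have : `|dl i * phi a| <= 1 by rewrite normrM mulr_ile1.
  by rewrite ler_norml => /andP[].
rewrite -mulr_suml big_split /= -mulr_sumr phi_sum0 mulr0 addr0.
by rewrite sumr_const card_ord divff // gt_eqF.
Qed.

Lemma tilt_high dl i :
  \sum_a tilt dl i a * (high a)%:R = hfrac + dl i * (hfrac * (1 - hfrac)).
Proof.
under eq_bigr => a _ do rewrite mulrAC mulrDl mul1r -mulrA.
rewrite -mulr_suml big_split /= -mulr_sumr phi_high mulrDl -/hfrac; congr (_ + _).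
by rewrite mulrA mulfK // gt_eqF.
Qed.

Lemma monotone_le (g : grid m n -> bool) (x y : grid m n) : Defs.monotone g ->
  (forall i, (x i <= y i)%N) -> (g x <= g y)%N.
Proof. by move=> mg xy; have [->//|/eqP ne] := eqVneq x y; apply: mg; split. Qed.

(** One coordinate at a time: raising [dl i] adds a nonnegative multiple of the correlation of [phi]
    and [G], two nondecreasing functions of one coordinate. *)
Lemma Ex_tilt_mono (dl dl' : 'I_n -> R) (g : grid m n -> bool) : Defs.monotone g ->
  (forall i, `|dl i| <= 1) -> (forall i, `|dl' i| <= 1) ->
  (forall i, dl i <= dl' i) ->
  Ex (tilt dl) (fun x => (g x)%:R) <= Ex (tilt dl') (fun x => (g x)%:R).
Proof.
move=> mg dl1 dl'1 le_dl; rewrite -subr_le0 -[leRHS](mulr0 n%:R).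
apply: Ex_hybrid; try exact: tilt_distr.
move=> i x; pose G a : R := (g (upd x i a))%:R.
have mid : (m./2 < m)%N by lia.
have Gphi : 0 <= \sum_a phi a * G a.
  (* As [phi] sums to 0, [G] may be shifted by its value at the first high point, where [phi] turns
     from negative to positive; then no term is negative. *)
  have -> : \sum_a phi a * G a = \sum_a phi a * (G a - G (Ordinal mid)).
    under [RHS]eq_bigr => a _ do rewrite mulrBr.
    by rewrite sumrB -mulr_suml phi_sum0 mul0r subr0.
  apply: sumr_ge0 => a _.
  have /andP[? ?] := hfrac_bounds; rewrite /phi /G /high.
  have upd_le (c c' : 'I_m) : (c <= c')%N -> (g (upd x i c) <= g (upd x i c'))%N.
    by move=> cc'; apply: monotone_le => // j; rewrite !ffunE; case: eqP.
  case: (leqP m./2 a) => ha /=.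
    by rewrite mulr_ge0 // subr_ge0 ?ler_nat ?upd_le //; lra.
  by rewrite mulr_le0 // subr_le0 ?ler_nat ?upd_le //; [lra | exact: ltnW].
have -> : \sum_a (tilt dl i a - tilt dl' i a) * (g (upd x i a))%:R =
    (dl i - dl' i) / m%:R * \sum_a phi a * G a.
  by rewrite mulr_sumr; apply: eq_bigr => a _; rewrite /tilt /G; field; rewrite gt_eqF.
by rewrite mulr_le0_ge0 // mulr_le0_ge0 ?subr_le0 ?invr_ge0 // ltW.
Qed.

(* [W x * [E x] <= lam * [E x] + W x ^+ 2 / (4 * lam)] for the density [W]. *)
Lemma Ex_tilt_le (dl : 'I_n -> R) (del lam : R) (E : grid m n -> bool) :
  (forall i, `|dl i| <= del) -> 0 < lam ->
  Ex (tilt dl) (fun x => (E x)%:R) <=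
  lam * Ex (@unifw R _ _) (fun x => (E x)%:R) + (1 + del ^+ 2) ^+ n / (4 * lam).
Proof.
move=> dle lam0; pose W (x : grid m n) : R := \prod_i (1 + dl i * phi (x i)).
have tiltE x : prodw (tilt dl) x = prodw (@unifw R _ _) x * W x.
  rewrite /prodw /W -big_split /=; apply: eq_bigr => i _.
  by rewrite /tilt /unifw card_ord mulrC.
have -> : Ex (tilt dl) (fun x => (E x)%:R) = Ex (@unifw R _ _) (fun x => W x * (E x)%:R).
  by apply: eq_bigr => x _; rewrite tiltE mulrA.
have U0 : forall (i : 'I_n) (a : 'I_m), 0 <= @unifw R _ _ i a.
  by move=> i a; rewrite invr_ge0 ler0n.
apply: (@le_trans _ _ (Ex (@unifw R _ _)
   (fun x => lam * (E x)%:R + (4 * lam)^-1 * W x ^+ 2))).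
  apply: le_Ex => // x; case: (E x) => /=; last first.
    by rewrite !mulr0 add0r mulr_ge0 ?sqr_ge0 // invr_ge0 mulr_ge0 // ltW.
  rewrite !mulr1 -subr_ge0.
  have -> : lam + (4 * lam)^-1 * W x ^+ 2 - W x = (2 * lam - W x) ^+ 2 / (4 * lam).
    by field; rewrite gt_eqF.
  by rewrite divr_ge0 ?sqr_ge0 // mulr_ge0 // ltW.
rewrite ExD !ExZ lerD2l mulrC ler_wpM2r //.
  by rewrite invr_ge0 mulr_ge0 // ltW.
(* The density [W] is a product, so its second moment factors over the coordinates. *)
have -> : Ex (@unifw R _ _) (fun x => W x ^+ 2) =
    \prod_i \sum_a (@unifw R _ _ i a * (1 + dl i * phi a) ^+ 2).
  rewrite bigA_distr_bigA; apply: eq_bigr => x _.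
  by rewrite /prodw /W -prodrXl -big_split.
have -> : (1 + del ^+ 2) ^+ n = \prod_(i < n) (1 + del ^+ 2).
  by rewrite prodr_const card_ord.
apply: ler_prod => i _.
apply/andP; split; first by apply: sumr_ge0 => a _; rewrite mulr_ge0 ?sqr_ge0.
have -> : \sum_a (@unifw R _ _ i a * (1 + dl i * phi a) ^+ 2) =
   1 + dl i ^+ 2 * (hfrac * (1 - hfrac)).
  transitivity ((\sum_a (1 + 2 * dl i * phi a + dl i ^+ 2 * phi a ^+ 2)) / m%:R).
    rewrite mulr_suml; apply: eq_bigr => a _; rewrite /unifw card_ord mulrC.
    by congr (_ / _); ring.
  rewrite !big_split /= -!mulr_sumr phi_sum0 phi_sqr sumr_const card_ord mulr0 addr0.
  by field; rewrite gt_eqF.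
rewrite lerD2l -[leRHS]mulr1; have /andP[? ?] := hfrac_bounds.
apply: ler_pM; rewrite ?sqr_ge0 //; [nra| |nra].
by rewrite -[leLHS]real_normK ?num_real // lerXn2r ?nnegrE // (le_trans _ (dle i)).
Qed.

End Tilting.

(** * Distance to monotone of functions with many negative weights *)

Lemma Pr_neqE (R : realType) m n (f g : grid m n -> bool) :
  Pr_neq R f g = Ex (@unifw R _ _) (fun x => (f x != g x)%:R).
Proof.
rewrite /Pr_neq /Ex.
under [RHS]eq_bigr => x _ do rewrite /prodw /unifw prodr_const.
rewrite -mulr_sumr mulrC; congr (_ * _).
  by rewrite card_ffun natrX exprVn.
by rewrite -natr_sum -sum1dep_card big_mkcond.
Qed.

Section Farness.
Variables (R : realType) (m n L : nat).
Hypotheses (m_ge2 : (2 <= m)%N) (L_gt0 : (0 < L)%N).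
Variable w : {ffun 'I_n -> 'I_L.+1}.

Let wt (i : 'I_n) : R := (w i)%:R - 1.
Let hm := hfrac R m.
Let mean (dl : 'I_n -> R) : R := \sum_i wt i * (hm + dl i * (hm * (1 - hm))).

Lemma score_concentrated (dl : 'I_n -> R) (t : R) :
  (forall i, `|dl i| <= 1) -> 0 < t ->
  Ex (tilt dl) (fun x : grid m n => (t <= `|(score w x)%:~R - mean dl|)%R%:R)
    <= n%:R * L%:R ^+ 2 / t ^+ 2.
Proof.
move=> dl1 t0; have dd := tilt_distr m_ge2 dl1.
pose Y i (a : 'I_m) : R := wt i * ((high a)%:R - (hm + dl i * (hm * (1 - hm)))).
have Y0 i : \sum_a tilt dl i a * Y i a = 0.
  under eq_bigr => a _ do rewrite /Y mulrCA mulrBr.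
  rewrite -mulr_sumr sumrB tilt_high // -mulr_suml dd.2 mul1r subrr mulr0 //.
(* The weight lies in [[-1, L - 1]] and the tilted probability of the upper half in [[0, 1]]. *)
have YL i a : `|Y i a| <= L%:R.
  rewrite normrM -[leRHS]mulr1; apply: ler_pM => //.
    have wL : (w i)%:R <= L%:R :> R by rewrite ler_nat -ltnS.
    have w0 : 0 <= (w i)%:R :> R by [].
    have L1 : 1 <= L%:R :> R by rewrite ler1n.
    by rewrite ler_norml /wt; lra.
  have /andP[h1 h2] : 1 / 3 <= hm <= 2 / 3 := hfrac_bounds R m_ge2.
  have := dl1 i; rewrite !ler_norml => /andP[d1 d2].
  set v := hm * (1 - hm).
  have v0 : 0 <= v by rewrite /v; nra.
  have v1 : v <= 1 - hm by rewrite /v; nra.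
  have v2 : v <= hm by rewrite /v; nra.
  have dv1 : - v <= dl i * v by nra.
  have dv2 : dl i * v <= v by nra.
  by case: high => /=; lra.
have := chebyshev_prodw dd Y0 YL t0; rewrite card_ord; apply: le_trans.
rewrite le_eqVlt; apply/orP; left; apply/eqP.
apply: eq_Ex => x; congr ((_ <= `|_|)%R%:R).
rewrite /score rmorph_sum /= /mean -sumrB; apply: eq_bigr => i _.
rewrite /Y [RHS]mulrBr; congr (_ - _); rewrite /wt.
case: (high (x i)) => /=; last by rewrite mulr0n mulr0.
by rewrite mulr1n mulr1 rmorphB /=.
Qed.

(** [N] counts the weights -1. Tilting them by [del] or [- del] moves the mean score down or up by
    at least [del * (2 / 9) * N], past [th] by a margin [t] at which Chebyshev's bound is at most
    1/4. *)
Lemma ltf_far (del t : R) (th : int) (g : grid m n -> bool)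
    (N : R := \sum_i (w i == ord0)%:R) (mean0 : R := \sum_i wt i * hm) :
  0 <= del -> del <= 1 -> 0 < t -> 4 * (n%:R * L%:R ^+ 2) <= t ^+ 2 ->
  mean0 - del * (2 / 9) * N + t <= th%:~R -> th%:~R <= mean0 + del * (2 / 9) * N - t ->
  Defs.monotone g -> (16 * (1 + del ^+ 2) ^+ n)^-1 <= Pr_neq R (ltf w th) g.
Proof.
move=> del0 del1 t0 t2 th_lo th_hi mg.
pose dl (s : R) i := s * (w i == ord0)%:R.
have dl_le s i : `|s| <= del -> `|dl s i| <= del.
  by rewrite /dl; case: eqP => _ /=; rewrite ?mulr1 // mulr0 normr0.
have [pos neg] : `|del| <= del /\ `|- del| <= del by rewrite normrN ger0_norm.
have dl1 s : `|s| <= del -> forall i, `|dl s i| <= 1.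
  by move=> sd i; apply: le_trans (dl_le _ _ sd) del1.
have N0 : 0 <= N by apply: sumr_ge0.
have hv : 2 / 9 <= hm * (1 - hm) := hvar_ge R m_ge2.
have meanE s : mean (dl s) = mean0 - s * (hm * (1 - hm)) * N.
  rewrite /mean /mean0 /N mulr_sumr -sumrB; apply: eq_bigr => i _.
  rewrite /dl /wt; case: eqP => [->|_] /=; ring.
have dN : del * (2 / 9) * N <= del * (hm * (1 - hm)) * N.
  by rewrite ler_wpM2r // ler_wpM2l.
have quarter : n%:R * L%:R ^+ 2 / t ^+ 2 <= 1 / 4 by rewrite ler_pdivrMr ?exprn_gt0 //; lra.
have Qpos : Ex (tilt (dl del)) (fun x : grid m n => (ltf w th x)%:R) <= 1 / 4.
  apply: le_trans quarter; apply: le_trans (score_concentrated (dl1 _ pos) t0).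
  apply: le_Ex => [|x]; first by case: (tilt_distr m_ge2 (dl1 _ pos)).
  rewrite ler_nat /ltf; case: (leP th) => //= hs.
  rewrite lt0b; apply: le_trans (ler_norm _); rewrite meanE.
  have : (th%:~R <= (score w x)%:~R :> R) by rewrite ler_int.
  by lra.
have Qneg : Ex (tilt (dl (- del))) (fun x : grid m n => (~~ ltf w th x)%:R) <= 1 / 4.
  apply: le_trans quarter; apply: le_trans (score_concentrated (dl1 _ neg) t0).
  apply: le_Ex => [|x]; first by case: (tilt_distr m_ge2 (dl1 _ neg)).
  rewrite ler_nat /ltf; case: (leP th) => //= hs.
  rewrite lt0b distrC; apply: le_trans (ler_norm _); rewrite meanE.
  have : ((score w x)%:~R < th%:~R :> R) by rewrite ltr_int.
  by lra.
have Qg : Ex (tilt (dl (- del))) (fun x : grid m n => (g x)%:R) <=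
    Ex (tilt (dl del)) (fun x : grid m n => (g x)%:R).
  apply: (Ex_tilt_mono m_ge2 mg (dl1 _ neg) (dl1 _ pos)) => i.
  by rewrite /dl; case: eqP => _ /=; rewrite ?mulr1 ?mulr0 //; lra.
set E := fun x : grid m n => ltf w th x != g x.
have Epos : Ex (tilt (dl del)) (fun x : grid m n => (g x)%:R) -
    Ex (tilt (dl del)) (fun x : grid m n => (ltf w th x)%:R) <=
    Ex (tilt (dl del)) (fun x : grid m n => (E x)%:R).
  rewrite -ExB; apply: le_Ex => [|x]; first by case: (tilt_distr m_ge2 (dl1 _ pos)).
  by rewrite /E; case: (ltf w th x); case: (g x) => /=; lra.
have Eneg : 1 - Ex (tilt (dl (- del))) (fun x : grid m n => (~~ ltf w th x)%:R) -
    Ex (tilt (dl (- del))) (fun x : grid m n => (g x)%:R) <=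
    Ex (tilt (dl (- del))) (fun x : grid m n => (E x)%:R).
  have dd := tilt_distr m_ge2 (dl1 _ neg).
  rewrite -{1}(Ex1 dd) -!ExB; apply: le_Ex => [|x]; first by case: dd.
  by rewrite /E; case: (ltf w th x); case: (g x) => /=; lra.
set K := (1 + del ^+ 2) ^+ n.
have K0 : 0 < K by rewrite exprn_gt0 // ltr_pwDl ?sqr_ge0.
(* The disagreements under the two tilts add up to at least 1 - 1/4 - 1/4. With [lam = 2 * K] each
   is at most [2 * K * P + 1 / 8], where [P] is the uniform disagreement, so
   [4 * K * P >= 1 / 4]. *)
have lam0 : 0 < 2 * K by rewrite mulr_gt0.
have := Ex_tilt_le m_ge2 E (fun i => dl_le del i pos) lam0.
have := Ex_tilt_le m_ge2 E (fun i => dl_le (- del) i neg) lam0.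
rewrite Pr_neqE -/E -/K (_ : K / (4 * (2 * K)) = 1 / 8); last by field; rewrite gt_eqF.
set P := Ex (@unifw _ _ _) _ => bneg bpos.
rewrite -[leLHS]mul1r ler_pdivrMr ?mulr_gt0 //.
by lra.
Qed.

End Farness.

(** * Yes instances are monotone, typical no instances are far *)

(** An odd entry is at least 1, so every weight [w i - 1] is nonnegative. *)
Lemma ltf_monotone m n L (w : {ffun 'I_n -> 'I_L.+1}) (th : int) :
  (forall i, odd (w i)) -> Defs.monotone (@ltf m n L w th).
Proof.
move=> w_odd x y [xy _]; rewrite /ltf; case: (leP th) => //= th_x.
rewrite lt0b; apply: le_trans th_x _; apply: ler_sum => i _.
have w1 : 0 <= (w i)%:Z - 1 :> int by have := odd_gt0 (w_odd i); lia.
rewrite /high; case: (leqP _ (x i)) => hx; case: (leqP _ (y i)) => hy //=.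
by have := leq_ltn_trans (leq_trans hx (xy i)) hy; rewrite ltnn.
Qed.

Section NoInstances.
Variables (R : realType) (n L : nat) (s : R).
Hypotheses (L_gt0 : (0 < L)%N) (s_ge1 : 1 <= s) (s_sqr : s ^+ 2 = n%:R).

Let tau : R := (parity_mass R L)^-1.
Let mu : R := \sum_(j < L.+1) pw R false j * j%:R.

Let tau_gt0 : 0 < tau.
Proof. by rewrite invr_gt0 (lt_le_trans ltr01) // parity_mass_ge1. Qed.

Let tau_le1 : tau <= 1.
Proof. by rewrite invf_le1 ?parity_mass_ge1 // (lt_le_trans ltr01) // parity_mass_ge1. Qed.

Let L_ge1 : 1 <= L%:R :> R.
Proof. by rewrite ler1n. Qed.

(** At these margins Chebyshev's inequality leaves 1/100 for each failure once
    [n >= 400 / tau ^+ 2]; [tau] is the probability of a weight -1 in the no case. *)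
Definition typical (w : {ffun 'I_n -> 'I_L.+1}) : bool :=
  (`|\sum_i ((w i)%:R - mu)| < 10 * L%:R * s)%R &&
  (tau / 2 * n%:R < \sum_i (w i == ord0)%:R)%R.

Lemma atypical_prob : 400 / tau ^+ 2 <= n%:R ->
  Ex (fun=> pw R false) (fun w => (~~ typical w)%:R) <= 1 / 50.
Proof.
move=> n_big; have dd := pw_distr R 'I_n false L_gt0; have [d0 d1] := dd.
have n0 : 0 < n%:R :> R by rewrite -s_sqr exprn_gt0 // (lt_le_trans ltr01).
have mu0 : 0 <= mu by apply: sumr_ge0 => j _; rewrite mulr_ge0 ?pw_ge0.
have jL (j : 'I_L.+1) : j%:R <= L%:R :> R by rewrite ler_nat -ltnS.
have muL : mu <= L%:R.
  have -> : L%:R = \sum_(j < L.+1) pw R false j * L%:R :> R by rewrite -mulr_suml pw_sum // mul1r.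
  by apply: ler_sum => j _; rewrite ler_wpM2l ?pw_ge0 ?jL.
have c1 := @chebyshev_prodw R 'I_n _ _ (fun _ (j : 'I_L.+1) => j%:R - mu) L%:R (10 * L%:R * s) dd.
have c2 := @chebyshev_prodw R 'I_n _ _ (fun _ (j : 'I_L.+1) => (j == ord0)%:R - tau) 1
  (tau / 2 * n%:R) dd.
rewrite card_ord in c1 c2.
have {}c1 : Ex (fun=> pw R false)
    (fun w : {ffun 'I_n -> 'I_L.+1} =>
       (10 * L%:R * s <= `|\sum_i ((w i)%:R - mu)|)%R%:R) <= 1 / 100.
  apply: le_trans (c1 _ _ _) _.
  - move=> i; under eq_bigr => j _ do rewrite mulrBr.
    by rewrite sumrB -mulr_suml (d1 i) mul1r subrr.
  - move=> _ j; have j0 : 0 <= j%:R :> R by [].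
    by rewrite ler_norml; have := jL j; clear d0 d1 c1 c2; lra.
  - by rewrite mulr_gt0 ?mulr_gt0 // (lt_le_trans ltr01).
  rewrite -s_sqr (_ : _ / _ = 1 / 100) //.
  have s0 : 0 < s := lt_le_trans ltr01 s_ge1.
  have L0 : 0 < L%:R :> R := lt_le_trans ltr01 L_ge1.
  by field; rewrite ?gt_eqF.
have {}c2 : Ex (fun=> pw R false)
    (fun w : {ffun 'I_n -> 'I_L.+1} =>
       (tau / 2 * n%:R <= `|\sum_i ((w i == ord0)%:R - tau)|)%R%:R) <= 1 / 100.
  apply: le_trans (c2 _ _ _) _.
  - move=> i; under eq_bigr => j _ do rewrite mulrBr.
    rewrite sumrB -mulr_suml (d1 i) mul1r (bigD1 ord0) //= big1 => [|j /negbTE ->]; last first.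
      by rewrite mulr0.
    by rewrite pw_ord0 mulr1 addr0 subrr.
  - move=> _ j; rewrite ler_norml; clear d0 d1 c2.
    by move: tau_gt0 tau_le1; case: eqP => _ /=; lra.
  - by rewrite mulr_gt0 // divr_gt0.
  have -> : n%:R * 1 ^+ 2 / (tau / 2 * n%:R) ^+ 2 = 4 / tau ^+ 2 / n%:R.
    by field; rewrite !gt_eqF.
  by rewrite ler_pdivrMr //; clear d0 d1 c2; lra.
clear d1; apply: (@le_trans _ _ (1 / 100 + 1 / 100)); last by clear d0; lra.
apply: le_trans (lerD c1 c2); rewrite -ExD; apply: le_Ex => // w.
rewrite /typical negb_and -!leNgt.
set b1 := (10 * _ * _ <= _)%R; case: b1 => /=; first by rewrite lerDl.
rewrite add0r ler_nat; case: leP => //= small; rewrite lt0b.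
rewrite sumrB sumr_const card_ord -[tau *+ n]mulr_natr -normrN.
by apply: le_trans (ler_norm _); clear d0; lra.
Qed.

(** With [del = far_slope / s], the drift [del * (2 / 9) * (tau / 2 * n)] equals
    [(12 * L + 1) * s]. *)
Definition far_slope : R := 9 * (12 * L%:R + 1) / tau.
(** As [(1 + far_slope ^+ 2 / n) ^+ n <= expR (far_slope ^+ 2)], this is at most half the bound of
    [ltf_far]; the slack gives the strict inequality in farness. *)
Definition far_eps : R := (32 * expR (far_slope ^+ 2))^-1.

Lemma far_eps_gt0 : 0 < far_eps.
Proof. by rewrite invr_gt0 mulr_gt0 // expR_gt0. Qed.

(** The mean score of a random no function at a uniform point, rounded down. *)
Definition base_threshold m : int := Num.floor (hfrac R m * (n%:R * (mu - 1))).

Lemma typical_far m (w : {ffun 'I_n -> 'I_L.+1}) (t : nat) : (2 <= m)%N ->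
  far_slope <= s -> t%:R <= s -> typical w ->
  far_from_monotone far_eps (@ltf m n L w (base_threshold m + t%:Z)).
Proof.
move=> m2 slope_s ts /andP[wmu Nbig] [g [mg close]].
have s0 : 0 < s := lt_le_trans ltr01 s_ge1.
have slope0 : 0 < far_slope by rewrite divr_gt0 // mulr_gt0 //; lra.
pose del := far_slope / s.
have del0 : 0 <= del by rewrite divr_ge0 ?ltW.
have del1 : del <= 1 by rewrite ler_pdivrMr // mul1r.
have Ls : s <= L%:R * s by rewrite ler_peMl // ltW.
have drift : (12 * L%:R + 1) * s <= del * (2 / 9) * \sum_i (w i == ord0)%:R.
  apply: (@le_trans _ _ (del * (2 / 9) * (tau / 2 * n%:R))); last first.
    by apply: ler_wpM2l (ltW Nbig); rewrite mulr_ge0.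
  rewrite -s_sqr /del /far_slope le_eqVlt; apply/orP; left; apply/eqP.
  by field; rewrite !gt_eqF.
have /andP[h1 h2] := hfrac_bounds R m2.
set c := hfrac R m * (n%:R * (mu - 1)).
have meanE : \sum_i ((w i)%:R - 1) * hfrac R m = c + hfrac R m * \sum_i ((w i)%:R - mu).
  rewrite -mulr_suml !sumrB !sumr_const card_ord -[1 *+ n]mulr_natr -[mu *+ n]mulr_natr /c.
  by ring.
have thE : (base_threshold m + t%:Z)%:~R = (base_threshold m)%:~R + t%:R :> R by rewrite rmorphD.
have flo : (base_threshold m)%:~R <= c by rewrite /base_threshold floor_le.
have fhi : c < (base_threshold m)%:~R + 1.
  by have := floorD1_gt c; rewrite rmorphD.
have t0 : 0 <= t%:R :> R by [].
move: wmu; rewrite ltr_norml => /andP[wlo whi].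
set S := \sum_i ((w i)%:R - mu) in wlo whi meanE.
have mlo : - (10 * L%:R * s) <= hfrac R m * S by nra.
have mhi : hfrac R m * S <= 10 * L%:R * s by nra.
set x := del * (2 / 9) * _ in drift; set hS := hfrac R m * S in mlo mhi meanE.
(* The drift [(12 * L + 1) * s] pays [10 * L * s] for the total weight, [2 * L * s] for the
   deviation of the score, and [s] for rounding or for the offset [t]. *)
have arith_lo (c' y h C l t' : R) : c' < C + 1 -> (12 * l + 1) * s <= y -> h <= 10 * l * s ->
    1 <= s -> 0 <= t' -> c' + h - y + 2 * l * s <= C + t' by lra.
have arith_hi (c' y h C l t' : R) : C <= c' -> (12 * l + 1) * s <= y -> - (10 * l * s) <= h ->
    t' <= s -> C + t' <= c' + h + y - 2 * l * s by lra.
have K_le : (1 + del ^+ 2) ^+ n <= expR (far_slope ^+ 2).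
  have -> : far_slope ^+ 2 = n%:R * del ^+ 2.
    by rewrite -s_sqr /del; field; rewrite gt_eqF.
  rewrite expRM_natl; apply: lerXn2r; rewrite ?nnegrE ?expR_ge0 ?expR_ge1Dx //.
  by rewrite addr_ge0 ?sqr_ge0.
have K_gt0 : 0 < (1 + del ^+ 2) ^+ n by rewrite exprn_gt0 // ltr_pwDl ?sqr_ge0.
have far : (16 * (1 + del ^+ 2) ^+ n)^-1 <= Pr_neq R (ltf w (base_threshold m + t%:Z)) g.
  apply: (@ltf_far R m n L m2 L_gt0 w del (2 * L%:R * s)) => //.
  - by rewrite mulr_gt0 // mulr_gt0 // (lt_le_trans ltr01).
  - by rewrite -s_sqr le_eqVlt; apply/orP; left; apply/eqP; ring.
  - by rewrite meanE thE -/x; apply: (arith_lo _ _ _ _ _ _ fhi drift mhi s_ge1 t0).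
  - by rewrite meanE thE -/x; apply: (arith_hi _ _ _ _ _ _ flo drift mlo ts).
have := le_trans far close; apply/negP; rewrite -ltNge /far_eps.
by rewrite ltf_pV2 ?posrE ?mulr_gt0 ?expR_gt0 //; lra.
Qed.

End NoInstances.

(** * Acceptance probabilities and the inequality on the number of queries *)

Lemma Pr_outputE (R : realType) m n q (A : nonadaptive_algorithm R m n q) f :
  Pr_output A f true = \sum_a alg_weight A a * (output a f)%:R.
Proof.
rewrite /Pr_output big_mkcond; apply: eq_bigr => a _.
by case: (output a f); rewrite ?mulr1 ?mulr0.
Qed.

Lemma Pr_output_total (R : realType) m n q (A : nonadaptive_algorithm R m n q) f :
  Pr_output A f true + Pr_output A f false = 1.
Proof.
rewrite -(alg_weight_sum1 A) (bigID (fun a => output a f)) /=; congr (_ + _).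
  by apply: eq_bigl => a; rewrite eqb_id.
by apply: eq_bigl => a; rewrite eqbF_neg.
Qed.

Lemma Pr_output_ge0 (R : realType) m n q (A : nonadaptive_algorithm R m n q) f b :
  0 <= Pr_output A f b.
Proof. by apply: sumr_ge0 => a _; apply: alg_weight_ge0. Qed.

Section QueryBound.
Variables (R : realType) (m n q L D T : nat) (s : R).
Variable A : nonadaptive_algorithm R m n q.
Hypotheses (m_ge2 : (2 <= m)%N) (L_gt0 : (0 < L)%N) (T_gt0 : (0 < T)%N).
Hypotheses (s_ge1 : 1 <= s) (s_sqr : s ^+ 2 = n%:R) (T_le : T%:R <= s).
Hypotheses (slope_le : far_slope R L <= s)
  (n_big : 400 / (parity_mass R L)^-1 ^+ 2 <= n%:R).
Hypothesis A_tests : tests_monotonicity (far_eps R L) A.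

Let W := {ffun 'I_n -> 'I_L.+1}.
Let th (t : 'I_T) : int := base_threshold R n L m + t%:Z.
Let accept (w : W) : R := (\sum_t Pr_output A (ltf w (th t)) true) / T%:R.

Let T0 : 0 < T%:R :> R. Proof. by rewrite ltr0n. Qed.

Lemma accept_yes : 2 / 3 <= Ex (fun=> pw R true) accept.
Proof.
have dd := pw_distr R 'I_n true L_gt0; have [d0 d1] := dd.
rewrite -[leLHS](Ex_cst _ dd); apply: le_Ex_supp => // w w_supp.
have w_odd i : odd (w i).
  by have := w_supp i; rewrite /pw; case: (odd (w i)) => //=; rewrite !mul0r eqxx.
rewrite ler_pdivlMr // -[X in _ * X%:R](card_ord T) mulr_natr -sumr_const.
by apply: ler_sum => t _; apply: (A_tests _).1; apply: ltf_monotone.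
Qed.

(** A typical [w] is accepted with probability at most 1/3; an atypical one may always be accepted,
    which costs 1/50. *)
Lemma accept_no : Ex (fun=> pw R false) accept <= 1 / 3 + 1 / 50.
Proof.
have dd := pw_distr R 'I_n false L_gt0; have [d0 d1] := dd.
apply: le_trans (lerD (lexx (1 / 3)) (atypical_prob L_gt0 s_ge1 s_sqr n_big)).
rewrite -[X in X + _](Ex_cst _ dd) -ExD; apply: le_Ex => // w.
rewrite ler_pdivrMr // -[X in _ * X%:R](card_ord T) mulr_natr -sumr_const.
apply: ler_sum => t _; have tot := Pr_output_total A (ltf w (th t)).
have [typ|_] /= := boolP (typical s w); last first.
  by have := Pr_output_ge0 A (ltf w (th t)) false; clear d0 d1; lra.
have far : far_from_monotone (far_eps R L) (@ltf m n L w (th t)).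
  have t_le : t%:R <= s by apply: le_trans T_le; rewrite ler_nat ltnW.
  exact (typical_far L_gt0 s_ge1 s_sqr m_ge2 slope_le t_le typ).
by have := (A_tests _).2 far; clear d0 d1; lra.
Qed.

(** The gap in acceptance is at least 1/3 - 1/50 > 1/4, yet it is an average over deterministic
    algorithms of gaps bounded by [indistinguishable]. *)
Lemma query_bound :
  1 / 4 <= 2 * (L%:R * (q%:R * D.+1%:R / T%:R)) + n%:R * (2 * q%:R / D.+1%:R) ^+ L
    :> R.
Proof.
set err := leRHS.
pose out (a : det_algorithm m n q) (w : W) : R :=
  (\sum_(t < T) (output a (ltf w (th t)))%:R) / T%:R.
have acceptE w : accept w = \sum_a alg_weight A a * out a w.
  rewrite /accept; under eq_bigr => t _ do rewrite Pr_outputE.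
  rewrite exchange_big /= mulr_suml; apply: eq_bigr => a _.
  by rewrite -mulr_sumr mulrA.
have gap : Ex (fun=> pw R true) accept - Ex (fun=> pw R false) accept <= err.
  rewrite !(eq_Ex _ acceptE) !Ex_sum -sumrB -[err]mul1r -(alg_weight_sum1 A) mulr_suml.
  apply: ler_sum => a _; rewrite !ExZ -mulrBr; apply: ler_wpM2l; first exact: alg_weight_ge0.
  by apply: le_trans (ler_norm _) _; rewrite distrC; apply: indistinguishable.
by have := accept_yes; have := accept_no; lra.
Qed.

End QueryBound.

(** * Choice of parameters *)

(** With [r] about [n^(1/20)], the sizes of [q], the noise and the window become integer powers:
    [r^4], [r^5] and [r^10] up to constants. *)
Lemma root20_floor (n : nat) : exists r : nat, (r ^ 20 <= n < r.+1 ^ 20)%N.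
Proof.
have ex0 : exists r : nat, (r ^ 20 <= n)%N by exists 0%N.
have bnd (r : nat) : (r ^ 20 <= n)%N -> (r <= n)%N.
  by apply: leq_trans; case: r => // r; rewrite -{1}[r.+1]expn1 leq_pexp2l.
case: (ex_maxnP ex0 bnd) => r rn rmax; exists r; rewrite rn ltnNge /=.
by apply/negP => /rmax; rewrite ltnn.
Qed.

Theorem theorem1p2 (R : realType) :
  exists eps0 : R, 0 < eps0 /\
  exists (c : R) (k N : nat), 0 < c /\
  forall m n q : nat, (2 <= m)%N -> (N <= n)%N ->
  forall A : nonadaptive_algorithm R m n q,
    tests_monotonicity eps0 A ->
    c * (n%:R `^ (5%:R)^-1) / (ln n%:R) ^+ k <= q%:R.
Proof.
(* 21 is the least [L] for which [r ^ 20 * (1 / r) ^ L] tends to 0; [LE] keeps powers with exponent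
   [L] symbolic. *)
have [L LE] : {L | L = 21%N} by exists 21%N.
have L_gt0 : (0 < L)%N by rewrite LE.
exists (far_eps R L); split; first exact: far_eps_gt0.
(* The numerators of the two error terms, both over [r]; 672 is 2 * 21 * 16. *)
have [C C_gt0 CE] : exists2 C : R, 0 < C & C = 672 + 2 ^+ 20 * 32 ^+ L.
  eexists; last reflexivity; apply: addr_gt0; first by rewrite ltr0n.
  by apply: mulr_gt0; apply: exprn_gt0; rewrite ltr0n.
pose tau2 : R := (parity_mass R L)^-1 ^+ 2.
(* [r > B] yields [C / r < 1 / 4], [n >= 400 / tau2], [far_slope <= s] and [s >= 1] at once. *)
pose B := 4 * C + 400 / tau2 + far_slope R L ^+ 2 + 1.
have B1 : 0 <= 400 / tau2 by apply: divr_ge0; rewrite ?ler0n ?sqr_ge0.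
have B2 : 0 <= far_slope R L ^+ 2 by rewrite sqr_ge0.
have B_ge0 : 0 <= B by rewrite /B; lra.
pose K := Num.bound B.
have BK : B < K%:R by exact: archi_boundP.
(* The exponent 0 means that no logarithm is lost; [n >= K ^ 20] forces [r >= K]. *)
exists 1, 0%N, (K ^ 20)%N; split=> // m n q m2 Kn A tA.
rewrite mul1r expr0 divr1 leNgt; apply/negP => q_small.
have [r /andP[rn nr]] := root20_floor n.
have Kr : (K <= r)%N.
  by rewrite -ltnS -(@ltn_exp2r _ _ 20) // (leq_ltn_trans Kn).
have K_gt0 : (0 < K)%N by rewrite -(ltr0n R); apply: le_lt_trans B_ge0 BK.
have r_gt0 : (0 < r)%N by apply: leq_trans Kr.
have r0 : 0 < r%:R :> R by rewrite ltr0n.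
have Br : B < r%:R by apply: lt_le_trans BK _; rewrite ler_nat.
have n_lt : (n < (2 * r) ^ 20)%N.
  by apply: leq_trans nr _; rewrite leq_exp2r // mul2n -addnn -addn1 leq_add2l.
have q5n : (q ^ 5 < n)%N.
  rewrite -(ltr_nat R) natrX.
  have -> : n%:R = (n%:R `^ 5%:R^-1) ^+ 5 :> R.
    by rewrite -powR_mulrn ?powR_ge0 // -powRrM mulVf // powRr1.
  by rewrite ltr_pXn2r // nnegrE ?powR_ge0.
(* [q ^ 5 < n < (2 * r) ^ 20 = (16 * r ^ 4) ^ 5]. *)
have q_le : (q <= 16 * r ^ 4)%N.
  apply: ltnW; rewrite -(@ltn_exp2r _ _ 5) //; apply: leq_trans q5n _.
  by apply: leq_trans (ltnW n_lt) _; rewrite (_ : 16 = 2 ^ 4)%N // -expnMn -expnM.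
pose s : R := Num.sqrt n%:R.
have s_sqr : s ^+ 2 = n%:R by rewrite sqr_sqrtr.
have s_ge0 : 0 <= s by exact: sqrtr_ge0.
have r10s : (r ^ 10)%:R <= s.
  rewrite -(@ler_pXn2r _ 2) ?nnegrE // s_sqr -natrX ler_nat -expnM //.
have r_le : r%:R <= (r ^ 10)%:R :> R by rewrite ler_nat -{1}[r]expn1 leq_pexp2l.
have s_ge1 : 1 <= s by move: B_ge0; rewrite /B in Br *; clear CE; lra.
have r_n : r%:R <= n%:R :> R.
  by apply: le_trans r_le _; rewrite ler_nat; apply: leq_trans rn; rewrite leq_pexp2l.
have slope_le : far_slope R L <= s.
  have [//|lt_s] := leP (far_slope R L) s.
  have : s ^+ 2 <= far_slope R L ^+ 2.
    by rewrite lerXn2r ?nnegrE // ?(le_trans s_ge0) // ltW.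
  by rewrite s_sqr; rewrite /B in Br; clear CE; lra.
have n_big : 400 / tau2 <= n%:R by rewrite /B in Br; clear CE; lra.
have T_gt0 : (0 < r ^ 10)%N by rewrite expn_gt0 r_gt0.
(* The noise takes [D.+1] values, so [D] is the predecessor of [r ^ 5]. *)
have D1 : (r ^ 5).-1.+1 = (r ^ 5)%N by rewrite prednK // expn_gt0 r_gt0.
have := @query_bound R m n q L (r ^ 5).-1 (r ^ 10) s A m2 L_gt0 T_gt0 s_ge1 s_sqr r10s
  slope_le n_big tA.
apply/negP; rewrite -ltNge D1 !natrX.
have qR : q%:R <= 16 * r%:R ^+ 4 :> R by rewrite -natrX -natrM ler_nat.
have nR : n%:R <= (2 * r%:R) ^+ 20 :> R by rewrite -natrM -natrX ler_nat ltnW.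
have e1 : 2 * (L%:R * (q%:R * r%:R ^+ 5 / r%:R ^+ 10)) <= 672 / r%:R :> R.
  have -> : 672 / r%:R = 2 * (L%:R * (16 * r%:R ^+ 4 * r%:R ^+ 5 / r%:R ^+ 10)) :> R.
    by rewrite LE; field; rewrite gt_eqF.
  rewrite ler_wpM2l // ler_wpM2l // ler_wpM2r ?invr_ge0 ?exprn_ge0 //.
  by rewrite ler_wpM2r // exprn_ge0.
have e2 : n%:R * (2 * q%:R / r%:R ^+ 5) ^+ L <= 2 ^+ 20 * 32 ^+ L / r%:R :> R.
  have q32 : 2 * q%:R / r%:R ^+ 5 <= 32 / r%:R :> R.
    have -> : 32 / r%:R = 2 * (16 * r%:R ^+ 4) / r%:R ^+ 5 :> R.
      by field; rewrite gt_eqF.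
    by rewrite ler_wpM2r ?invr_ge0 ?exprn_ge0 // ler_wpM2l.
  have -> : 2 ^+ 20 * 32 ^+ L / r%:R = (2 * r%:R) ^+ 20 * (32 / r%:R) ^+ L :> R.
    rewrite exprMn exprMn exprVn {3}LE [r%:R ^+ 21]exprS.
    have y0 := exprn_gt0 20 r0; move: y0; set y := r%:R ^+ 20 => y0.
    set v := 32 ^+ L; set u := 2 ^+ 20; clearbody u v y.
    by field; rewrite !gt_eqF.
  apply: ler_pM => //.
  apply: lerXn2r => //; rewrite nnegrE ?divr_ge0 ?mulr_ge0 ?exprn_ge0 //.
apply: le_lt_trans (lerD e1 e2) _.
rewrite -mulrDl -CE ltr_pdivrMr //.
by rewrite /B in Br; clear CE; lra.
Qed.
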